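(* Let $\Bbbk$ be any field and $\alpha,\beta,\gamma\in\Bbbk$. If $\alpha\beta\gamma\neq0$ and $\alpha+\beta+\gamma+\alpha\beta\gamma\neq0$, then $x_0^2$, $x_1^2$, $x_2^2$ and $x_3^2$ belong to the center of $A(\alpha,\beta,\gamma)$.
   Context: Write $[x,y]=xy-yx$, $\{x,y\}=xy+yx$. $A(\alpha,\beta,\gamma)$ is the free algebra $\Bbbk\langle x_0,x_1,x_2,x_3\rangle$ modulo the six relations $$[x_0,x_1]=\alpha\{x_2,x_3\},\quad [x_0,x_2]=\beta\{x_3,x_1\},\quad [x_0,x_3]=\gamma\{x_1,x_2\},$$ $$\{x_0,x_1\}=[x_2,x_3],\quad \{x_0,x_2\}=[x_3,x_1],\quad \{x_0,x_3\}=[x_1,x_2].$$ *)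

(* Defs.v *)
From HB Require Import structures.
From mathcomp Require Import all_boot all_algebra boolp.
From mathcomp Require Import finmap.
From mathcomp.multinomials Require Import monalg.

Set Implicit Arguments.
Unset Strict Implicit.
Unset Printing Implicit Defensive.

Import GRing.Theory.
Local Open Scope ring_scope.
Local Open Scope quotient_scope.

Definition center (R : pzRingType) : {pred R} :=
  fun x => `[< forall y : R, x * y = y * x >].
Arguments center R : clear implicits.

Lemma centerP (R : pzRingType) (x : R) :
  reflect (forall y, x * y = y * x) (x \in center R).
Proof. exact: asboolP. Qed.

Definition commutator (R : pzRingType) (x y : R) : R := x * y - y * x.
Definition anticommutator (R : pzRingType) (x y : R) : R := x * y + y * x.

(* The two-sided ideal of R generated by the elements of rs: all finite sums
   of products a * r * b with r \in rs, such a product being encoded by the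
   triple (a, r, b). *)
Section GeneratedIdeal.
Variables (R : nzRingType) (rs : seq R).

Definition in_ideal_gen (x : R) : Prop :=
  exists2 s : seq (R * R * R),
    {in s, forall t, t.1.2 \in rs} & x = \sum_(t <- s) t.1.1 * t.1.2 * t.2.

Definition ideal_gen : {pred R} := fun x => `[< in_ideal_gen x >].

Lemma ideal_genP x : reflect (in_ideal_gen x) (x \in ideal_gen).
Proof. exact: asboolP. Qed.

Lemma ideal_gen_incl r : r \in rs -> r \in ideal_gen.
Proof.
move=> rs_r; apply/ideal_genP; exists [:: (1, r, 1)].
  by move=> t; rewrite inE => /eqP->.
by rewrite big_seq1 /= mul1r mulr1.
Qed.

Lemma ideal_gen_mull a x : x \in ideal_gen -> a * x \in ideal_gen.
Proof.
move=> /ideal_genP[s s_rs ->]; apply/ideal_genP.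
exists [seq (a * t.1.1, t.1.2, t.2) | t <- s].
  by move=> _ /mapP[t /s_rs rs_t ->].
by rewrite big_map mulr_sumr; apply: eq_bigr => t _; rewrite /= !mulrA.
Qed.

Lemma ideal_gen_mulr a x : x \in ideal_gen -> x * a \in ideal_gen.
Proof.
move=> /ideal_genP[s s_rs ->]; apply/ideal_genP.
exists [seq (t.1.1, t.1.2, t.2 * a) | t <- s].
  by move=> _ /mapP[t /s_rs rs_t ->].
by rewrite big_map mulr_suml; apply: eq_bigr => t _; rewrite /= !mulrA.
Qed.

Lemma ideal_gen_zmod_closed : zmod_closed ideal_gen.
Proof.
have add x y : x \in ideal_gen -> y \in ideal_gen -> x + y \in ideal_gen.
  move=> /ideal_genP[s s_rs ->] /ideal_genP[s' s'_rs ->]; apply/ideal_genP.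
  exists (s ++ s'); last by rewrite big_cat.
  by move=> t; rewrite mem_cat => /orP[/s_rs|/s'_rs].
split=> [|x y Ix Iy].
  by apply/ideal_genP; exists [::]; rewrite ?big_nil.
by apply: add => //; rewrite -mulN1r ideal_gen_mull.
Qed.

HB.instance Definition _ := GRing.isZmodClosed.Build R ideal_gen
  ideal_gen_zmod_closed.

Definition quot_ring : Type := Quotient.quot ideal_gen.
HB.instance Definition _ := GRing.Zmodule.on quot_ring.
HB.instance Definition _ := EqQuotient.on quot_ring.

Definition qone : quot_ring := \pi_quot_ring 1.
Definition qmul := lift_op2 quot_ring *%R.

Lemma quot_ringE x y :
  (\pi_quot_ring x = \pi_quot_ring y) <-> (x - y \in ideal_gen).
Proof. by split=> [/eqP|xy]; [|apply/eqP]; rewrite -Quotient.idealrBE. Qed.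

Lemma pi_qmul : {morph \pi_quot_ring : x y / x * y >-> qmul x y}.
Proof.
move=> x y; unlock qmul; apply/quot_ringE.
rewrite -[_ * _](addrNK (x * repr (\pi_quot_ring y))) -mulrBr -addrA -mulrBl.
apply: rpredD; [apply: ideal_gen_mull|apply: ideal_gen_mulr];
  by apply/quot_ringE; rewrite reprK.
Qed.

Lemma qmulA : associative qmul.
Proof.
by move=> x y z; rewrite -[x]reprK -[y]reprK -[z]reprK -!pi_qmul mulrA.
Qed.

Lemma qmul1r : left_id qone qmul.
Proof. by move=> x; rewrite -[x]reprK -pi_qmul mul1r. Qed.

Lemma qmulr1 : right_id qone qmul.
Proof. by move=> x; rewrite -[x]reprK -pi_qmul mulr1. Qed.

Lemma qmulDl : left_distributive qmul +%R.
Proof.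
move=> x y z; rewrite -[x]reprK -[y]reprK -[z]reprK.
by rewrite -(raddfD \pi_quot_ring) -!pi_qmul mulrDl raddfD.
Qed.

Lemma qmulDr : right_distributive qmul +%R.
Proof.
move=> x y z; rewrite -[x]reprK -[y]reprK -[z]reprK.
by rewrite -(raddfD \pi_quot_ring) -!pi_qmul mulrDr raddfD.
Qed.

HB.instance Definition _ := GRing.Zmodule_isPzRing.Build quot_ring
  qmulA qmul1r qmulr1 qmulDl qmulDr.

End GeneratedIdeal.

Section QuotientAlgebra.
Variables (k : comNzRingType) (B : algType k) (rs : seq B).

Definition qscale (c : k) := lift_op1 (quot_ring rs) ( *:%R c).

Lemma pi_qscale c : {morph \pi_(quot_ring rs) : x / c *: x >-> qscale c x}.
Proof.
move=> x; unlock qscale; apply/quot_ringE.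
rewrite -scalerBr -[X in c *: X]mul1r scalerAl; apply: ideal_gen_mull.
by apply/quot_ringE; rewrite reprK.
Qed.

Lemma qscaleA a b v : qscale a (qscale b v) = qscale (a * b) v.
Proof. by rewrite -[v]reprK -!pi_qscale scalerA. Qed.

Lemma qscale1 : left_id 1 qscale.
Proof. by move=> v; rewrite -[v]reprK -!pi_qscale scale1r. Qed.

Lemma qscaleDr : right_distributive qscale +%R.
Proof.
move=> a u v; rewrite -[u]reprK -[v]reprK.
by rewrite -(raddfD \pi_(quot_ring rs)) -!pi_qscale scalerDr raddfD.
Qed.

Lemma qscaleDl v : {morph qscale^~ v : a b / a + b}.
Proof.
move=> a b; rewrite -[v]reprK -!pi_qscale.
by rewrite -(raddfD \pi_(quot_ring rs)) scalerDl.
Qed.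

HB.instance Definition _ := GRing.Zmodule_isLmodule.Build k (quot_ring rs)
  qscaleA qscale1 qscaleDr qscaleDl.

Lemma quot_scalerAl (a : k) (u v : quot_ring rs) : a *: (u * v) = a *: u * v.
Proof.
rewrite -[u]reprK -[v]reprK -[LHS]/(qscale a (qmul _ _)).
by rewrite -[RHS]/(qmul (qscale a _) _) -!(pi_qmul, pi_qscale) scalerAl.
Qed.

Lemma quot_scalerAr (a : k) (u v : quot_ring rs) : a *: (u * v) = u * (a *: v).
Proof.
rewrite -[u]reprK -[v]reprK -[LHS]/(qscale a (qmul _ _)).
by rewrite -[RHS]/(qmul _ (qscale a _)) -!(pi_qmul, pi_qscale) scalerAr.
Qed.

End QuotientAlgebra.

Lemma malg_scalerAr (k : comNzRingType) (K : monomType) (c : k)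
  (f g : {malg k[K]}) : c *: (f * g) = f * (c *: g).
Proof.
apply/malgP => m; rewrite mcoeffZ.
rewrite (mcoeffMlw m (fsubset_refl (msupp f)) (msuppZ_le c g)).
rewrite mcoeffMl mulr_sumr; apply: eq_bigr => m1 _; rewrite mulr_sumr.
by apply: eq_bigr => m2 _; rewrite mcoeffZ mulrnAr mulrCA.
Qed.

(* The free algebra on a set I of noncommuting variables is the monoid algebra
   of the free monoid {fmonom I}. *)
Section FreeAlgebra.
Variables (k : comNzRingType) (I : choiceType).

Definition free_alg : Type := {malg k[{fmonom I}]}.
HB.instance Definition _ := GRing.Lmodule.on free_alg.

(* The product of {malg k[{fmonom I}]}, locked so that comparing two products
   does not unfold them to finitely supported functions. *)
Definition free_mul : free_alg -> free_alg -> free_alg :=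
  locked (@GRing.mul {malg k[{fmonom I}]}).

Lemma free_mulE f g : free_mul f g = (f : {malg k[{fmonom I}]}) * g.
Proof. by rewrite /free_mul -lock. Qed.

Lemma free_mulA : associative free_mul.
Proof. by move=> f g h; rewrite !free_mulE; exact: mulrA. Qed.

Lemma free_mul1r : left_id (1 : {malg k[{fmonom I}]}) free_mul.
Proof. by move=> f; rewrite free_mulE; exact: mul1r. Qed.

Lemma free_mulr1 : right_id (1 : {malg k[{fmonom I}]}) free_mul.
Proof. by move=> f; rewrite free_mulE; exact: mulr1. Qed.

Lemma free_mulDl : left_distributive free_mul +%R.
Proof. by move=> f g h; rewrite !free_mulE; exact: mulrDl. Qed.

Lemma free_mulDr : right_distributive free_mul +%R.
Proof. by move=> f g h; rewrite !free_mulE; exact: mulrDr. Qed.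

Lemma free_one_neq0 : (1 : {malg k[{fmonom I}]}) != 0.
Proof. exact: oner_neq0. Qed.

HB.instance Definition _ := GRing.Zmodule_isNzRing.Build free_alg
  free_mulA free_mul1r free_mulr1 free_mulDl free_mulDr free_one_neq0.

Lemma free_scalerAl (c : k) (f g : free_alg) :
  c *: free_mul f g = free_mul (c *: f) g.
Proof. by rewrite !free_mulE; exact: scalerAl. Qed.

HB.instance Definition _ := GRing.Lmodule_isLalgebra.Build k free_alg
  free_scalerAl.

Definition fvar (i : I) : free_alg := << fmu i >>.

Lemma free_scalerAr (c : k) (f g : free_alg) :
  c *: free_mul f g = free_mul f (c *: g).
Proof. by rewrite !free_mulE; exact: malg_scalerAr. Qed.

HB.instance Definition _ := GRing.Lalgebra_isAlgebra.Build k free_alg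
  free_scalerAr.

Definition const_term : free_alg -> k := mcoeff mone.

Lemma const_term_zmod_morphism : zmod_morphism const_term.
Proof. exact: (raddfB (mcoeff mone)). Qed.

Lemma const_term_monoid_morphism : monoid_morphism const_term.
Proof.
split=> [|f g]; first exact: (rmorph1 (mcoeff mone)).
change (const_term (free_mul f g) = const_term f * const_term g).
by rewrite free_mulE; exact: (rmorphM (mcoeff mone)).
Qed.

HB.instance Definition _ := GRing.isZmodMorphism.Build free_alg k const_term
  const_term_zmod_morphism.
HB.instance Definition _ := GRing.isMonoidMorphism.Build free_alg k const_term
  const_term_monoid_morphism.

Lemma const_termZ c f : const_term (c *: f) = c * const_term f.
Proof. exact: mcoeffZ. Qed.

Lemma const_term_fvar i : const_term (fvar i) = 0.
Proof. by rewrite /const_term /fvar mcoeffU1 fm1_eq1. Qed.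

End FreeAlgebra.

Section AlgebraA.
Variables (k : fieldType) (alpha beta gamma : k).

Local Notation X i := (@fvar k 'I_4 i).

(* The indices 0, 1, 2, 3 : 'I_4 are numerals of the ring of integers mod 4, so
   they denote four distinct variables. *)
Definition relatorsA : seq (free_alg k 'I_4) :=
  [:: commutator (X 0) (X 1) - alpha *: anticommutator (X 2) (X 3);
      commutator (X 0) (X 2) - beta *: anticommutator (X 3) (X 1);
      commutator (X 0) (X 3) - gamma *: anticommutator (X 1) (X 2);
      anticommutator (X 0) (X 1) - commutator (X 2) (X 3);
      anticommutator (X 0) (X 2) - commutator (X 3) (X 1);
      anticommutator (X 0) (X 3) - commutator (X 1) (X 2)].

Definition algA : Type := quot_ring relatorsA.

HB.instance Definition _ := GRing.PzRing.on algA.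
HB.instance Definition _ := GRing.Lmodule.on algA.

Lemma const_term_relatorsA r : r \in relatorsA -> const_term r = 0.
Proof.
have C i j : const_term (commutator (X i) (X j)) = 0.
  by rewrite rmorphB !rmorphM /= !const_term_fvar !mul0r subrr.
have D i j : const_term (anticommutator (X i) (X j)) = 0.
  by rewrite rmorphD !rmorphM /= !const_term_fvar !mul0r addr0.
rewrite !inE => /orP[|/orP[|/orP[|/orP[|/orP[]]]]] /eqP->;
  by rewrite rmorphB /= ?const_termZ !(C, D) ?mulr0 subrr.
Qed.

Lemma algA_nontrivial : 1 != 0 :> algA.
Proof.
apply/eqP => eq10.
have /quot_ringE : \pi_(quot_ring relatorsA) 1 = \pi_(quot_ring relatorsA) 0.
  by rewrite raddf0; exact: eq10.
rewrite subr0 => /ideal_genP[s s_rs] /(congr1 (@const_term k 'I_4)).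
rewrite rmorph1 rmorph_sum big_seq big1 => [/eqP|t /s_rs].
  by rewrite oner_eq0.
by move=> /const_term_relatorsA r0; rewrite !rmorphM /= r0 mulr0 mul0r.
Qed.

HB.instance Definition _ := GRing.PzSemiRing_isNonZero.Build algA
  algA_nontrivial.
HB.instance Definition _ := GRing.Lmodule_isLalgebra.Build k algA
  (@quot_scalerAl k _ relatorsA).
HB.instance Definition _ := GRing.Lalgebra_isAlgebra.Build k algA
  (@quot_scalerAr k _ relatorsA).

Definition genA (i : 'I_4) : algA := \pi_(quot_ring relatorsA) (X i).

End AlgebraA.

(* Main.v *)
Require Import Defs.
From mathcomp Require Import all_boot all_algebra.
From mathcomp Require Import ring.
From mathcomp.multinomials Require Import monalg.
Import GRing.Theory.
Local Open Scope ring_scope.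
Local Open Scope quotient_scope.

(** Write c_ij = [x_i^2, x_j].  Since [a^2, b] = [a, {a, b}] = {a, [a, b]},
    each c_ij with i != j is a double bracket, and the relations turn its inner
    bracket, of either kind, into the opposite kind of bracket of the two other
    generators.  The Jacobi identity and its mixed analogue
      {a, {b, c}} = [[a, b], c] + {b, {a, c}}
    then expand it into brackets to which the relations apply once more, and
    which are again of the form c_ij.  Expanding [x_0, {x_0, x_1}] in one way
    and {x_0, [x_0, x_1]} in two ways (the arguments of {x_2, x_3} can be
    exchanged) gives three linear equations in c_01, c_21, c_31; exchanging the
    roles of x_0 and x_1 gives three in c_10, c_20, c_30.  Up to sign, both
    systems have determinant
      alpha (alpha + beta + gamma + alpha beta gamma),
    so that all six elements vanish.  No division by 2 occurs, which is why the
    characteristic is arbitrary.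

    The relations are invariant under the simultaneous cyclic permutations of
    x_1, x_2, x_3 and of alpha, beta, gamma, which yields the remaining c_ij;
    the factor alpha of the determinant becomes beta and gamma.
    Finally, an element commuting with the generators is central, because the
    free algebra is spanned by words. *)

(** * Commutators and anticommutators *)

Section Brackets.
Context {R : pzRingType}.
Implicit Types a b c : R.

Lemma commutatorC a b : commutator b a = - commutator a b.
Proof. by rewrite /commutator opprB. Qed.

Lemma anticommutatorC a b : anticommutator b a = anticommutator a b.
Proof. by rewrite /anticommutator addrC. Qed.

Lemma commutatorNl a b : commutator (- a) b = - commutator a b.
Proof. by rewrite /commutator mulNr mulrN opprD. Qed.

Lemma commutatorNr a b : commutator a (- b) = - commutator a b.
Proof. by rewrite commutatorC commutatorNl -commutatorC. Qed.

Lemma anticommutatorNr a b : anticommutator a (- b) = - anticommutator a b.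
Proof. by rewrite /anticommutator mulNr mulrN -opprD. Qed.

Lemma commutator_sqr_anti a b :
  commutator (a ^+ 2) b = commutator a (anticommutator a b).
Proof.
by rewrite /commutator /anticommutator mulrDr mulrDl !mulrA opprD addrA addrK.
Qed.

Lemma commutator_sqr a b :
  commutator (a ^+ 2) b = anticommutator a (commutator a b).
Proof. by rewrite /commutator /anticommutator mulrBr mulrBl !mulrA subrKA. Qed.

Lemma commutatorM a b c :
  commutator a (b * c) = commutator a b * c + b * commutator a c.
Proof. by rewrite /commutator mulrBl mulrBr !mulrA subrKA. Qed.

Lemma anticommutatorM a b c :
  anticommutator a (b * c) = commutator a b * c + b * anticommutator a c.
Proof. by rewrite /commutator /anticommutator mulrBl mulrDr !mulrA subrKA. Qed.

Lemma anticommutatorM_anti a b c :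
  anticommutator a (b * c) = anticommutator a b * c - b * commutator a c.
Proof.
rewrite /commutator /anticommutator mulrBr mulrDl !mulrA opprB.
by rewrite addrACA subrr addr0.
Qed.

Lemma commutator_jacobi a b c :
  commutator a (commutator b c) =
  commutator (commutator a b) c + commutator b (commutator a c).
Proof.
have -> : commutator a (commutator b c) =
          commutator a (b * c) - commutator a (c * b).
  by rewrite /commutator mulrBr mulrBl opprD addrACA -opprD.
by rewrite !commutatorM [X in _ - X]addrC opprD addrACA.
Qed.

(** The products b c and c b are expanded by different Leibniz rules, chosen so
    that the terms carrying [a, b] combine into a commutator and those carrying
    {a, c} into an anticommutator. *)
Lemma anticommutator_jacobi a b c :
  anticommutator a (anticommutator b c) =
  commutator (commutator a b) c + anticommutator b (anticommutator a c).
Proof.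
have -> : anticommutator a (anticommutator b c) =
          anticommutator a (b * c) + anticommutator a (c * b).
  by rewrite /anticommutator mulrDr mulrDl addrACA.
by rewrite anticommutatorM anticommutatorM_anti [X in _ + X]addrC addrACA.
Qed.

End Brackets.

Section ScaledBrackets.
Context {k : comNzRingType} {R : algType k}.
Implicit Types (a b : R) (t : k).

Lemma commutatorZl t a b : commutator (t *: a) b = t *: commutator a b.
Proof. by rewrite /commutator -scalerAl -scalerAr scalerBr. Qed.

Lemma commutatorZr t a b : commutator a (t *: b) = t *: commutator a b.
Proof. by rewrite /commutator -scalerAl -scalerAr scalerBr. Qed.

Lemma anticommutatorZr t a b :
  anticommutator a (t *: b) = t *: anticommutator a b.
Proof. by rewrite /anticommutator -scalerAl -scalerAr scalerDr. Qed.

End ScaledBrackets.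

(** * Linear systems over a field *)

Lemma lmod_cramer2 {k : fieldType} {V : lmodType k} {a b c d : k} {u v : V} :
  a *: u + b *: v = 0 -> c *: u + d *: v = 0 -> a * d - b * c != 0 ->
  u = 0 /\ v = 0.
Proof.
move=> e1 e2 D0.
have Du : (a * d - b * c) *: u = 0.
  have -> : (a * d - b * c) *: u =
            d *: (a *: u + b *: v) - b *: (c *: u + d *: v).
    rewrite !scalerDr !scalerA opprD addrACA -!scalerBl.
    by rewrite (mulrC d b) subrr scale0r addr0 (mulrC d).
  by rewrite e1 e2 !scaler0 subr0.
have Dv : (a * d - b * c) *: v = 0.
  have -> : (a * d - b * c) *: v =
            a *: (c *: u + d *: v) - c *: (a *: u + b *: v).
    rewrite !scalerDr !scalerA opprD addrACA -!scalerBl.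
    by rewrite (mulrC c a) subrr scale0r add0r (mulrC c).
  by rewrite e1 e2 !scaler0 subr0.
split; apply/eqP.
  by move/eqP: Du; rewrite scaler_eq0 (negbTE D0).
by move/eqP: Dv; rewrite scaler_eq0 (negbTE D0).
Qed.

Lemma lmod_lincomb_eq {k : pzRingType} {V : lmodType k} {a b c d : k}
    {u v : V} :
  a *: u + b *: v = c *: u + d *: v -> (a - c) *: u + (b - d) *: v = 0.
Proof. by move=> e; rewrite !scalerBl addrACA -opprD e subrr. Qed.

(** * Squares of elements satisfying the relations *)

Section Relations.
Context {k : fieldType} {R : algType k}.

Definition relationsA (alpha beta gamma : k) (x0 x1 x2 x3 : R) : Prop :=
  [/\ commutator x0 x1 = alpha *: anticommutator x2 x3,
      commutator x0 x2 = beta *: anticommutator x3 x1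
    & commutator x0 x3 = gamma *: anticommutator x1 x2] /\
  [/\ anticommutator x0 x1 = commutator x2 x3,
      anticommutator x0 x2 = commutator x3 x1
    & anticommutator x0 x3 = commutator x1 x2].

Lemma relationsA_cycle {alpha beta gamma x0 x1 x2 x3} :
  relationsA alpha beta gamma x0 x1 x2 x3 ->
  relationsA beta gamma alpha x0 x2 x3 x1.
Proof. by case=> [[? ? ?] [? ? ?]]; split. Qed.

Context {alpha beta gamma : k} {x0 x1 x2 x3 : R}.
Hypothesis rel : relationsA alpha beta gamma x0 x1 x2 x3.

Local Notation c x y := (commutator (x ^+ 2) y).

Let r01 : commutator x0 x1 = alpha *: anticommutator x2 x3.
Proof. by case: rel => [[]]. Qed.
Let r02 : commutator x0 x2 = beta *: anticommutator x3 x1.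
Proof. by case: rel => [[]]. Qed.
Let r03 : commutator x0 x3 = gamma *: anticommutator x1 x2.
Proof. by case: rel => [[]]. Qed.
Let s01 : anticommutator x0 x1 = commutator x2 x3.
Proof. by case: rel => [_ []]. Qed.
Let s02 : anticommutator x0 x2 = commutator x3 x1.
Proof. by case: rel => [_ []]. Qed.
Let s03 : anticommutator x0 x3 = commutator x1 x2.
Proof. by case: rel => [_ []]. Qed.

Let anti_commutator_sqr (x y : R) :
  commutator (anticommutator y x) x = - c x y.
Proof. by rewrite commutatorC anticommutatorC commutator_sqr_anti. Qed.

(** The first equation comes from [x_0, {x_0, x_1}], the other two from
    {x_0, {x_2, x_3}} and {x_0, {x_3, x_2}}, which the mixed Jacobi identity
    expands differently. *)
Lemma sqr0_comm1_system :
  [/\ c x0 x1 = gamma *: c x2 x1 + - beta *: c x3 x1,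
      c x0 x1 = - alpha *: c x2 x1 + - (alpha * beta) *: c x3 x1
    & c x0 x1 = - (alpha * gamma) *: c x2 x1 + alpha *: c x3 x1].
Proof.
split.
- rewrite commutator_sqr_anti s01 commutator_jacobi r02 r03.
  rewrite commutatorZl commutatorZr (anticommutatorC x1) anti_commutator_sqr.
  rewrite (anticommutatorC x2 x1) -commutator_sqr_anti.
  by rewrite scalerN scaleNr addrC.
- rewrite commutator_sqr r01 anticommutatorZr anticommutator_jacobi s03 r02.
  rewrite commutatorZl (anticommutatorC x1) anti_commutator_sqr.
  rewrite (commutatorC x2) anticommutatorNr -commutator_sqr.
  by rewrite scalerDr !scalerN scalerA !scaleNr addrC.
- rewrite commutator_sqr r01 anticommutatorZr (anticommutatorC x3).
  rewrite anticommutator_jacobi s02 r03 commutatorZl anti_commutator_sqr.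
  by rewrite -commutator_sqr scalerDr !scalerN scalerA scaleNr.
Qed.

(** Here the expansions of {x_1, {x_2, x_3}} and {x_1, {x_3, x_2}} contain
    {x_1, x_3} and {x_1, x_2}, which the relations express only after
    multiplication by beta and gamma: hence the multiples of c_10 on the left. *)
Lemma sqr1_comm0_system :
  [/\ c x1 x0 = - c x2 x0 - c x3 x0,
      beta *: c x1 x0 = alpha *: c x2 x0 + (alpha * beta) *: c x3 x0
    & gamma *: c x1 x0 = - (alpha * gamma) *: c x2 x0 + alpha *: c x3 x0].
Proof.
have c10 : c x1 x0 = - alpha *: anticommutator x1 (anticommutator x2 x3).
  by rewrite commutator_sqr commutatorC r01 anticommutatorNr anticommutatorZr
             scaleNr.
split.
- rewrite commutator_sqr_anti anticommutatorC s01 commutator_jacobi -s03.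
  rewrite anti_commutator_sqr (commutatorC x3 x1) -s02 commutatorNr.
  by rewrite (anticommutatorC x2 x0) -commutator_sqr_anti addrC.
- rewrite c10 anticommutator_jacobi -s03 anti_commutator_sqr.
  rewrite (scalerA beta) (mulrC beta) -(scalerA (- alpha)) scalerDr -anticommutatorZr.
  rewrite (anticommutatorC x3 x1) -r02 (commutatorC x2) anticommutatorNr.
  by rewrite -commutator_sqr scalerN -opprD scalerN scaleNr opprK scalerDr scalerA
             addrC.
- rewrite c10 (anticommutatorC x3) anticommutator_jacobi (commutatorC x3) -s02.
  rewrite commutatorNl anti_commutator_sqr opprK.
  rewrite (scalerA gamma) (mulrC gamma) -(scalerA (- alpha)) scalerDr -anticommutatorZr.
  rewrite -r03 (commutatorC x3) anticommutatorNr -commutator_sqr.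
  by rewrite !scaleNr scalerBr opprD opprK scalerA.
Qed.

Hypothesis alpha_neq0 : alpha != 0.
Hypothesis sum_neq0 : alpha + beta + gamma + alpha * beta * gamma != 0.

Lemma sqr_comm1_eq0 : [/\ c x0 x1 = 0, c x2 x1 = 0 & c x3 x1 = 0].
Proof.
have [e1 e2 e3] := sqr0_comm1_system.
have /lmod_lincomb_eq e12 := etrans (esym e1) e2.
have /lmod_lincomb_eq e13 := etrans (esym e1) e3.
have [|c21 c31] := lmod_cramer2 e12 e13.
  have -> : (gamma - - alpha) * (- beta - alpha)
            - (- beta - - (alpha * beta)) * (gamma - - (alpha * gamma)) =
            - (alpha * (alpha + beta + gamma + alpha * beta * gamma)) by ring.
  by rewrite oppr_eq0 mulf_neq0.
by rewrite e1 c21 c31 !scaler0 addr0.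
Qed.

Lemma sqr_comm0_eq0 : [/\ c x1 x0 = 0, c x2 x0 = 0 & c x3 x0 = 0].
Proof.
(* Without the pattern, scalerBr would also distribute over the differences
   hidden in the commutators. *)
have [e1] := sqr1_comm0_system; rewrite e1 !(scalerBr _ (- _)) !scalerN -!scaleNr.
move=> /lmod_lincomb_eq e2 /lmod_lincomb_eq e3.
have [|c20 c30] := lmod_cramer2 e2 e3.
  have -> : (- beta - alpha) * (- gamma - alpha)
            - (- beta - alpha * beta) * (- gamma - - (alpha * gamma)) =
            alpha * (alpha + beta + gamma + alpha * beta * gamma) by ring.
  by rewrite mulf_neq0.
by rewrite c20 c30 subr0 oppr0.
Qed.

End Relations.

(** * Generation by the variables *)

Lemma free_alg_ind {k : comNzRingType} {I : choiceType}
    (P : free_alg k I -> Prop) :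
  P 1 -> (forall f g, P f -> P g -> P (f + g)) ->
  (forall t f, P f -> P (t *: f)) ->
  (forall i f, P f -> P (fvar k i * f)) ->
  forall f, P f.
Proof.
move=> P1 PD PZ PM f.
have Pm (m : {fmonom I}) : P (<< m >> : {malg k[{fmonom I}]}).
  case: m; elim=> [|i s Ps].
    suff -> : (<< FMonom [::] >> : {malg k[{fmonom I}]}) = 1 by [].
    by congr (<< _ >>); apply/eqP; rewrite fmP fm1.
  have := PM i _ Ps.
  suff -> : fvar k i * (<< FMonom s >> : {malg k[{fmonom I}]}) =
            << FMonom (i :: s) >> by [].
  rewrite -[LHS]/(free_mul _ _) free_mulE malgM_def fgmulUU mulr1.
  by congr (<< _ >>); apply/eqP; rewrite fmP fmM fmU.
rewrite (monalgE f); elim/big_ind: _ => //.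
  by have := PZ 0 _ P1; rewrite scale0r.
move=> m _.
suff -> : << f@_m *g m >> = f@_m *: << m >> by exact: PZ.
by apply/malgP=> m'; rewrite mcoeffZ !mcoeffU mulrnAr mulr1.
Qed.

Section Center.
Variables (k : fieldType) (alpha beta gamma : k).
Local Notation A := (algA alpha beta gamma).
Local Notation x := (genA alpha beta gamma).

Lemma algA_center (z : A) :
  (forall i, commutator z (x i) = 0) -> z \in center A.
Proof.
move=> zx; apply/centerP => y; rewrite -[y]reprK.
move: (repr y); elim/(@free_alg_ind k 'I_4) => [|f g Pf Pg|t f Pf|i f Pf].
- by rewrite -[X in z * X]/(1 : A) -[X in X * z]/(1 : A) mulr1 mul1r.
- by rewrite raddfD mulrDr mulrDl Pf Pg.
- by rewrite pi_qscale -[qscale _ _]/(t *: (_ : A)) -scalerAr -scalerAl Pf.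
rewrite pi_qmul -[qmul _ _]/(x i * (_ : A)) mulrA.
by have /eqP := zx i; rewrite subr_eq0 => /eqP->; rewrite -mulrA Pf mulrA.
Qed.

Let proj (f : free_alg k 'I_4) : A := \pi_(quot_ring _) f.

Let projM f g : proj (f * g) = proj f * proj g.
Proof. exact: (pi_qmul _ f g). Qed.

Let projZ t f : proj (t *: f) = t *: proj f.
Proof. exact: (pi_qscale _ t f). Qed.

Let proj_commutator f g :
  proj (commutator f g) = commutator (proj f) (proj g).
Proof. by rewrite /commutator -!projM; apply: (raddfB \pi_(quot_ring _)). Qed.

Let proj_anticommutator f g :
  proj (anticommutator f g) = anticommutator (proj f) (proj g).
Proof.
by rewrite /anticommutator -!projM; apply: (raddfD \pi_(quot_ring _)). Qed.

Let proj_eq f g : f - g \in relatorsA alpha beta gamma -> proj f = proj g.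
Proof. by move=> r; apply/quot_ringE; exact: ideal_gen_incl. Qed.

Lemma genA_relations : relationsA alpha beta gamma (x 0) (x 1) (x 2) (x 3).
Proof.
have in_rel n (n6 : (n < 6)%N) : (relatorsA alpha beta gamma)`_n
    \in relatorsA alpha beta gamma by exact: mem_nth.
have comm_eq t f g p q :
    commutator f g - t *: anticommutator p q \in relatorsA alpha beta gamma ->
    commutator (proj f) (proj g) = t *: anticommutator (proj p) (proj q).
  by move/proj_eq; rewrite projZ proj_commutator proj_anticommutator.
have anti_eq f g p q :
    anticommutator f g - commutator p q \in relatorsA alpha beta gamma ->
    anticommutator (proj f) (proj g) = commutator (proj p) (proj q).
  by move/proj_eq; rewrite proj_commutator proj_anticommutator.
split; split.
- exact: comm_eq (in_rel 0%N isT).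
- exact: comm_eq (in_rel 1%N isT).
- exact: comm_eq (in_rel 2%N isT).
- exact: anti_eq (in_rel 3%N isT).
- exact: anti_eq (in_rel 4%N isT).
- exact: anti_eq (in_rel 5%N isT).
Qed.

End Center.

Theorem proposition6p2 (k : fieldType) (alpha beta gamma : k)
    (habc : alpha * beta * gamma != 0)
    (hsum : alpha + beta + gamma + alpha * beta * gamma != 0) :
  [/\ genA alpha beta gamma 0 ^+ 2 \in center (algA alpha beta gamma),
      genA alpha beta gamma 1 ^+ 2 \in center (algA alpha beta gamma),
      genA alpha beta gamma 2 ^+ 2 \in center (algA alpha beta gamma)
    & genA alpha beta gamma 3 ^+ 2 \in center (algA alpha beta gamma)].
Proof.
have rel1 := genA_relations k alpha beta gamma.
have rel2 := relationsA_cycle rel1; have rel3 := relationsA_cycle rel2.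
move: (habc); rewrite !mulf_eq0 !negb_or -andbA => /and3P[a0 b0 c0].
have sum2 : beta + gamma + alpha + beta * gamma * alpha != 0.
  by move: hsum; congr (_ != 0); ring.
have sum3 : gamma + alpha + beta + gamma * alpha * beta != 0.
  by move: hsum; congr (_ != 0); ring.
have [c01 c21 c31] := sqr_comm1_eq0 rel1 a0 hsum.
have [c02 c32 c12] := sqr_comm1_eq0 rel2 b0 sum2.
have [c03 c13 c23] := sqr_comm1_eq0 rel3 c0 sum3.
have [c10 c20 c30] := sqr_comm0_eq0 rel1 a0 hsum.
have cdiag i : commutator (genA alpha beta gamma i ^+ 2)
                          (genA alpha beta gamma i) = 0.
  by rewrite /commutator expr2 mulrA subrr.
have central i : let c j := commutator (genA alpha beta gamma i ^+ 2)
                                       (genA alpha beta gamma j) in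
    c 0 = 0 -> c 1 = 0 -> c 2 = 0 -> c 3 = 0 ->
    genA alpha beta gamma i ^+ 2 \in center (algA alpha beta gamma).
  move=> c ci0 ci1 ci2 ci3; apply: algA_center => j.
  have : j \in [:: 0; 1; 2; 3 : 'I_4] by case: j => [[|[|[|[|]]]]].
  rewrite !inE => /or4P[] /eqP->;
    [exact: ci0 | exact: ci1 | exact: ci2 | exact: ci3].
split.
- exact: central (cdiag 0) c01 c02 c03.
- exact: central c10 (cdiag 1) c12 c13.
- exact: central c20 c21 (cdiag 2) c23.
- exact: central c30 c31 c32 (cdiag 3).
Qed.
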